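(* Let $\Gamma=(V,E,s,t)$ be a multiquiver and $\gamma:\mathbb{Z}V\to\mathbb{Z}E$ its incidence matrix. Then the rank of the kernel of $\gamma$ (as a free abelian group) is equal to the number of connected components of $\Gamma$ in equilibrium.
   Context: $\mathbb{Z}X$ denotes the free abelian group on a set $X$. A multiquiver $\Gamma=(V,E,s,t)$ consists of sets $V$ (vertices), $E$ (edges) and functions $s,t:E\to (V\times\mathbb{Z}_{>0})\cup\{\emptyset\}$ such that (no loops) if $s(e)=(u,m)$ and $t(e)=(v,n)$ then $u\ne v$; and (local finiteness) for each $v\in V$ only finitely many $e$ have $s(e)\in\{v\}\times\mathbb{Z}_{>0}$ or $t(e)\in\{v\}\times\mathbb{Z}_{>0}$. If $s(e)=(v,n)$ (resp. $t(e)=(v,n)$), $v$ is the source (resp. target) of $e$ and $n$ is the outgoing (resp. incoming) multiplicity of $e$ at $v$. An edge $e$ with $s(e)=\emptyset$ or $t(e)=\emptyset$ is called a leaf. The incidence matrix is $\gamma:\mathbb{Z}V\to\mathbb{Z}E$, $\gamma(v)=\sum_{e\in E}\gamma_{ev}e$, where $\gamma_{ev}=n$ if $t(e)=(v,n)$, $\gamma_{ev}=-n$ if $s(e)=(v,n)$, and $\gamma_{ev}=0$ otherwise. A subgraph of $\Gamma$ is given by subsets $V'\subseteq V$, $E'\subseteq E$ with $s'(e)=s(e)$ if the source of $e$ lies in $V'$ and $s'(e)=\emptyset$ otherwise, and likewise for $t'$. A multiquiver is a directed cycle if for some $n\ge1$ one can write $V=\{v_1,\dots,v_n\}$, $E=\{e_1,\dots,e_n\}$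 (distinct elements) with $s(e_i)=(v_i,n_i)$, $t(e_i)=(v_{i+1},m_i)$, $v_{n+1}=v_1$. It is balanced if $\prod n_i=\prod m_i$. Two multiquivers are sign-equivalent if they become isomorphic after reversing some edges (swapping $s(e)$ and $t(e)$). An NND (not necessarily directed) cycle is a multiquiver sign-equivalent to a directed cycle; it is balanced if it is sign-equivalent to a balanced directed cycle. A cycle in $\Gamma$ is a subgraph of $\Gamma$ that is a cycle. Connected components are those of the underlying undirected graph (an edge with neither source nor target forms its own component). A connected component is in equilibrium if it has finitely many vertices, no leaves, and every NND cycle in it is balanced. *)

(* Defs.v *)
From Stdlib Require Import Relation_Operators.
From HB Require Import structures.
From mathcomp.multinomials Require Import freeg.
From mathcomp Require Import all_boot all_order all_algebra.
From mathcomp Require Import finmap.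
From mathcomp Require Import mathcomp_extra boolp classical_sets functions.
From mathcomp Require Import cardinality fsbigop.

Set Implicit Arguments.
Unset Strict Implicit.
Unset Printing Implicit Defensive.

Import GRing.Theory Num.Theory.

Local Open Scope classical_set_scope.
Local Open Scope ring_scope.

(* [None] plays the role of the symbol $\emptyset$; a multiplicity is a [nat]
   required to be positive. *)
Record multiquiver := Multiquiver {
  vertex : choiceType;
  edge : choiceType;
  src : edge -> option (vertex * nat);
  tgt : edge -> option (vertex * nat);
  src_gt0 : forall e u m, src e = Some (u, m) -> (0 < m)%N;
  tgt_gt0 : forall e v n, tgt e = Some (v, n) -> (0 < n)%N;
  no_loops : forall e u m v n,
    src e = Some (u, m) -> tgt e = Some (v, n) -> u <> v;
  locally_finite : forall v : vertex,
    finite_set [set e | (exists n, src e = Some (v, n)) \/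
                        (exists n, tgt e = Some (v, n))]
}.

Arguments src {_} _.
Arguments tgt {_} _.

Section Incidence.
Variable G : multiquiver.

Definition incidence_coef (e : edge G) (v : vertex G) : int :=
  match tgt e, src e with
  | Some (u, n), Some (w, m) =>
      if u == v then n%:Z else if w == v then - m%:Z else 0
  | Some (u, n), None => if u == v then n%:Z else 0
  | None, Some (w, m) => if w == v then - m%:Z else 0
  | None, None => 0
  end.

(* The sum over all edges makes sense because its support is finite, by local
   finiteness. *)
Definition incidence (x : {freeg (vertex G) / int}) : {freeg (edge G) / int} :=
  fglift (fun v => \sum_(e \in [set: edge G]) << incidence_coef e v *g e >>) x.

Definition incidence_ker : set {freeg (vertex G) / int} :=
  [set x | incidence x = 0].

End Incidence.

Arguments incidence_ker : clear implicits.

Section Rank.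
Variable M : zmodType.

Definition is_Zbasis (K B : set M) : Prop :=
  [/\ B `<=` K,
      forall x, K x -> exists (s : seq M) (c : M -> int),
        [set` s] `<=` B /\ x = \sum_(b <- s) b *~ c b
    & forall (s : seq M) (c : M -> int), uniq s -> [set` s] `<=` B ->
        \sum_(b <- s) b *~ c b = 0 -> forall b, b \in s -> c b = 0].

(* The subgroup [K] is free abelian and its rank is the, possibly infinite,
   cardinal of [C]. *)
Definition free_of_rank (K : set M) (T : Type) (C : set T) : Prop :=
  exists B : set M, is_Zbasis K B /\ (B #= C)%card.

End Rank.

Section Subgraph.
Variables (G : multiquiver) (V' : set (vertex G)) (E' : set (edge G)).

(* [insub v] is [v] seen in [V'] when [v] belongs to [V'], and [None]
   otherwise. *)
Definition restrict_end (o : option (vertex G * nat)) : option (V' * nat) :=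
  obind (fun p => omap (fun v : V' => (v, p.2)) (insub p.1)) o.

Lemma restrict_endP o v n :
  restrict_end o = Some (v, n) -> o = Some (val v, n).
Proof.
case: o => [[u m]|] //=.
by case: insubP => //= w _ <- [-> ->].
Qed.

Definition sub_src (e : E') := restrict_end (src (val e)).
Definition sub_tgt (e : E') := restrict_end (tgt (val e)).

Lemma sub_src_gt0 e u m : sub_src e = Some (u, m) -> (0 < m)%N.
Proof. by move/restrict_endP/src_gt0. Qed.

Lemma sub_tgt_gt0 e v n : sub_tgt e = Some (v, n) -> (0 < n)%N.
Proof. by move/restrict_endP/tgt_gt0. Qed.

Lemma sub_no_loops e u m v n :
  sub_src e = Some (u, m) -> sub_tgt e = Some (v, n) -> u <> v.
Proof.
by move=> /restrict_endP es /restrict_endP et uv; apply: (no_loops es et); rewrite uv.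
Qed.

Lemma sub_locally_finite (v : V') :
  finite_set [set e | (exists n, sub_src e = Some (v, n)) \/
                      (exists n, sub_tgt e = Some (v, n))].
Proof.
have valI : {in val @^-1` [set e | (exists n, src e = Some (val v, n)) \/
    (exists n, tgt e = Some (val v, n))] &, injective (val : E' -> edge G)}.
  by move=> x y _ _; apply: val_inj.
apply: sub_finite_set (finite_preimage valI (locally_finite (val v))) => e.
by case=> -[n /restrict_endP en]; [left|right]; exists n.
Qed.

Definition subgraph : multiquiver :=
  Multiquiver sub_src_gt0 sub_tgt_gt0 sub_no_loops sub_locally_finite.

End Subgraph.

Section Reverse.
Variables (G : multiquiver) (R : set (edge G)).

Definition rev_src (e : edge G) := if e \in R then tgt e else src e.
Definition rev_tgt (e : edge G) := if e \in R then src e else tgt e.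

Lemma rev_src_gt0 e u m : rev_src e = Some (u, m) -> (0 < m)%N.
Proof. by rewrite /rev_src; case: ifP => _; [apply: tgt_gt0|apply: src_gt0]. Qed.

Lemma rev_tgt_gt0 e v n : rev_tgt e = Some (v, n) -> (0 < n)%N.
Proof. by rewrite /rev_tgt; case: ifP => _; [apply: src_gt0|apply: tgt_gt0]. Qed.

Lemma rev_no_loops e u m v n :
  rev_src e = Some (u, m) -> rev_tgt e = Some (v, n) -> u <> v.
Proof.
rewrite /rev_src /rev_tgt; case: ifP => _; last exact: no_loops.
by move=> et es uv; apply: (no_loops es et).
Qed.

Lemma rev_locally_finite (v : vertex G) :
  finite_set [set e | (exists n, rev_src e = Some (v, n)) \/
                      (exists n, rev_tgt e = Some (v, n))].
Proof.
apply: sub_finite_set (locally_finite v) => e /=.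
by rewrite /rev_src /rev_tgt; case: ifP => _ []; auto.
Qed.

Definition reverse : multiquiver :=
  Multiquiver rev_src_gt0 rev_tgt_gt0 rev_no_loops rev_locally_finite.

End Reverse.

Definition isomorphic (G H : multiquiver) : Prop :=
  exists (f : vertex G -> vertex H) (g : edge G -> edge H),
    [/\ bijective f, bijective g,
        forall e, src (g e) = omap (fun p => (f p.1, p.2)) (src e)
      & forall e, tgt (g e) = omap (fun p => (f p.1, p.2)) (tgt e)].

Definition sign_equivalent (G H : multiquiver) : Prop :=
  exists R : set (edge G), isomorphic (reverse R) H.

Definition cyclic_enum (D : multiquiver) (k : nat) (v : 'I_k -> vertex D)
    (e : 'I_k -> edge D) (n m : 'I_k -> nat) : Prop :=
  [/\ (0 < k)%N, bijective v, bijective e,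
      forall i, src (e i) = Some (v i, n i)
    & forall i, tgt (e i) = Some (v (ordS i), m i)].

Definition directed_cycle (D : multiquiver) : Prop :=
  exists k (v : 'I_k -> vertex D) (e : 'I_k -> edge D) (n m : 'I_k -> nat),
    cyclic_enum v e n m.

Definition balanced_directed_cycle (D : multiquiver) : Prop :=
  exists k (v : 'I_k -> vertex D) (e : 'I_k -> edge D) (n m : 'I_k -> nat),
    cyclic_enum v e n m /\ (\prod_(i < k) n i = \prod_(i < k) m i)%N.

Definition NND_cycle (G : multiquiver) : Prop :=
  exists D, directed_cycle D /\ sign_equivalent G D.

Definition balanced_NND_cycle (G : multiquiver) : Prop :=
  exists D, balanced_directed_cycle D /\ sign_equivalent G D.

Definition leaf (G : multiquiver) (e : edge G) : Prop :=
  src e = None \/ tgt e = None.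

Definition in_equilibrium (G : multiquiver) : Prop :=
  [/\ finite_set [set: vertex G],
      forall e : edge G, ~ leaf e
    & forall (V' : set (vertex G)) (E' : set (edge G)),
        NND_cycle (subgraph V' E') -> balanced_NND_cycle (subgraph V' E')].

Section Components.
Variable G : multiquiver.

(* Vertices and edges are treated on the same footing, so that an edge without
   source and target gives a component without vertices. *)
Definition incident (x y : vertex G + edge G) : Prop :=
  match x, y with
  | inl v, inr e => exists n, src e = Some (v, n) \/ tgt e = Some (v, n)
  | _, _ => False
  end.

Definition component (x : vertex G + edge G) : set (vertex G + edge G) :=
  [set y | clos_refl_sym_trans _ incident x y].

Definition components : set (set (vertex G + edge G)) := range component.

Definition component_graph (C : set (vertex G + edge G)) : multiquiver :=
  subgraph [set v | C (inl v)] [set e | C (inr e)].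

Definition equilibrium_components : set (set (vertex G + edge G)) :=
  [set C | components C /\ in_equilibrium (component_graph C)].

End Components.

Arguments equilibrium_components : clear implicits.

(* Main.v *)
Require Import Defs.
From Stdlib Require Import Relation_Operators.
From HB Require Import structures.
From mathcomp.multinomials Require Import freeg.
From mathcomp Require Import all_boot all_order all_algebra.
From mathcomp Require Import finmap.
From mathcomp Require Import boolp classical_sets functions cardinality fsbigop.
From mathcomp Require Import zify ring.

Set Implicit Arguments.
Unset Strict Implicit.
Unset Printing Implicit Defensive.

Import Order.TTheory GRing.Theory Num.Theory.

Local Open Scope classical_set_scope.
Local Open Scope ring_scope.

(** An element [x] of the kernel of the incidence matrix satisfies
    [m x(u) = n x(v)] on every edge from [(u, m)] to [(v, n)], and vanishes at
    the end of every leaf. Hence on a connected component it is determined by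
    its value at one vertex, and it vanishes either everywhere or nowhere. A
    nonzero value therefore forces the component to be finite and without
    leaves, and multiplying the equations around a cycle shows that the cycle
    is balanced. Conversely, if all the cycles of a component are balanced,
    then so are all its closed walks, by cutting a closed walk at a repeated
    vertex; transporting a value along walks then gives a rational solution,
    and clearing denominators an integral one. The kernel elements supported
    on such a component thus form an infinite cyclic group, and the kernel is
    the direct sum of these groups. *)

(** * Potentials and balanced cycles *)

(** A nowhere zero rational solution of the edge equations. Leaves impose nothing, so that
    potentials restrict to subgraphs, where edges may lose ends. *)
Definition potential (G : multiquiver) (phi : vertex G -> rat) : Prop :=
  (forall v, phi v != 0) /\
  forall e u m v n, src e = Some (u, m) -> tgt e = Some (v, n) ->
    m%:R * phi u = n%:R * phi v.

Lemma potential_reverse G (R : set (edge G)) (phi : vertex G -> rat) :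
  @potential (reverse R) phi <-> @potential G phi.
Proof.
split=> -[phi0 pot]; split=> // e u m v n.
  move: (pot e); rewrite /= /rev_src /rev_tgt.
  by case: ifP => _ {}pot es et; [symmetry|]; apply: pot.
rewrite /= /rev_src /rev_tgt.
by case: ifP => _ es et; [symmetry|]; apply: pot; eassumption.
Qed.

Lemma potential_iso G H (f : vertex G -> vertex H) (g : edge G -> edge H)
    (phi : vertex H -> rat) :
  (forall e, src (g e) = omap (fun p => (f p.1, p.2)) (src e)) ->
  (forall e, tgt (g e) = omap (fun p => (f p.1, p.2)) (tgt e)) ->
  potential phi -> potential (phi \o f).
Proof.
move=> gs gt [phi0 pot]; split=> [v|e u m v n es et] /=; first exact: phi0.
by apply: (pot (g e)); rewrite ?gs ?gt ?es ?et.
Qed.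

Lemma isomorphic_sym G H : isomorphic G H -> isomorphic H G.
Proof.
move=> [f [g [[f' fK f'K] [g' gK g'K] gs gt]]].
exists f', g'; split; [by exists f | by exists g | move=> e | move=> e].
- rewrite -{2}(g'K e) gs; case: (src (g' e)) => //= -[u m] /=.
  by rewrite fK.
- rewrite -{2}(g'K e) gt; case: (tgt (g' e)) => //= -[u m] /=.
  by rewrite fK.
Qed.

Lemma sign_equivalent_potential G H : sign_equivalent G H ->
  (exists phi, @potential G phi) <-> (exists phi, @potential H phi).
Proof.
move=> [R isoGH]; split=> -[phi pot].
  have [f [g [_ _ gs gt]]] := isomorphic_sym isoGH.
  exists (phi \o f); apply: potential_iso gs gt _.
  exact/potential_reverse.
have [f [g [_ _ gs gt]]] := isoGH.
exists (phi \o f); apply/(@potential_reverse _ R).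
exact: potential_iso gs gt pot.
Qed.

(** Multiplying the equations around the cycle, the values of [phi] contribute the same nonzero
    product to both sides, up to a cyclic shift. *)
Lemma cyclic_enum_balanced D k (v : 'I_k -> vertex D) e n m phi :
  cyclic_enum v e n m -> @potential D phi ->
  (\prod_(i < k) n i = \prod_(i < k) m i)%N.
Proof.
move=> [_ _ _ es et] [phi0 pot].
have prod0 : \prod_(i < k) phi (v i) != 0 by apply/prodf_neq0 => i _.
apply/eqP; rewrite -(eqr_nat rat) !natr_prod; apply/eqP.
apply: (mulIf prod0).
rewrite [X in _ = _ * X](reindex (@ordS k)) /=; last first.
  by exists (@ord_pred k) => i _; rewrite ?ordSK ?ord_predK.
rewrite -!big_split /=; apply: eq_bigr => i _.
exact: pot (es i) (et i).
Qed.

(** The value 1 at index 0 is propagated around the cycle, each edge multiplying it by [n i / m i];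
    balance makes it return to 1 after [k] edges. *)
Lemma balanced_cyclic_enum_potential D k (v : 'I_k -> vertex D) e n m :
  cyclic_enum v e n m -> (\prod_(i < k) n i = \prod_(i < k) m i)%N ->
  exists phi, @potential D phi.
Proof.
move=> [k0 [v' vK v'K] [e' eK e'K] es et] nm.
have n0 i : (n i)%:R != 0 :> rat.
  by rewrite pnatr_eq0 -lt0n; apply: src_gt0 (es i).
have m0 i : (m i)%:R != 0 :> rat.
  by rewrite pnatr_eq0 -lt0n; apply: tgt_gt0 (et i).
pose psi (j : nat) : rat := \prod_(i < k | (i < j)%N) ((n i)%:R / (m i)%:R).
have psiS (i : 'I_k) : psi i.+1 = psi i * ((n i)%:R / (m i)%:R).
  rewrite /psi (bigD1 i) //= mulrC; congr (_ * _).
  by apply: eq_bigl => j; rewrite ltnS ltn_neqAle -val_eqE andbC.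
have psi0 j : psi j != 0.
  by apply/prodf_neq0 => i _; rewrite mulf_neq0 ?invr_eq0.
have psik : psi k = psi 0%N.
  rewrite /psi [in RHS]big_pred0 //.
  rewrite (eq_bigl xpredT) => [|i]; last by rewrite ltn_ord.
  rewrite prodf_div -!natr_prod nm divff // natr_prod.
  exact/prodf_neq0.
exists (fun w => psi (v' w)); split=> // d u a w b.
rewrite -(e'K d) es et => -[<- <-] [<- <-]; rewrite !vK.
set i := e' d.
have -> : psi (ordS i) = psi i.+1.
  rewrite /=; case: (ltngtP i.+1 k) => [ik|ki|ik].
  - by rewrite modn_small.
  - by have := ltn_ord i; lia.
  - by rewrite ik modnn -psik.
by rewrite psiS; field.
Qed.

(** Together with the next lemma: an NND cycle is balanced exactly when it carries a potential, a
    criterion free of any choice of orientation. *)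
Lemma balanced_NND_potential G : balanced_NND_cycle G ->
  exists phi, @potential G phi.
Proof.
move=> [D [[k [v [e [n [m [enum nm]]]]]] GD]].
apply/(sign_equivalent_potential GD).
exact: balanced_cyclic_enum_potential enum nm.
Qed.

Lemma potential_balanced_NND G phi : @potential G phi ->
  NND_cycle G -> balanced_NND_cycle G.
Proof.
move=> pot [D [[k [v [e [n [m enum]]]]] GD]].
have [psi psiP] : exists psi, @potential D psi.
  by apply/(sign_equivalent_potential GD); exists phi.
exists D; split=> //; exists k, v, e, n, m; split=> //.
exact: cyclic_enum_balanced enum psiP.
Qed.

Lemma restrict_end_in G (V' : set (vertex G)) (v : V') w n : val v = w ->
  @restrict_end G V' (Some (w, n)) = Some (v, n).
Proof. by move=> <- /=; rewrite valK. Qed.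

Lemma potential_subgraph G (V' : set (vertex G)) (E' : set (edge G)) phi :
  @potential G phi -> @potential (subgraph V' E') (phi \o val).
Proof.
move=> [phi0 pot]; split=> [v|e u m v n /= es et]; first exact: phi0.
exact: pot (restrict_endP es) (restrict_endP et).
Qed.

Lemma potential_clear_denominators (H : multiquiver) (phi : vertex H -> rat) :
  potential phi -> finite_set [set: vertex H] ->
  exists z : vertex H -> int, (forall w, z w != 0) /\
    forall e u m v n, src e = Some (u, m) -> tgt e = Some (v, n) ->
      m%:Z * z u = n%:Z * z v.
Proof.
move=> [phi0 pot] /finite_fsetP[S SE].
have inS w : w \in S := ((seteqP _ _).1 SE).1 w I.
pose D : int := \prod_(w <- S) denq (phi w).
have D0 : D%:~R != 0 :> rat.
  by rewrite intr_eq0 prodf_seq_neq0; apply/allP => w _; rewrite denq_neq0.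
have /choice[z zE] : forall w, exists k : int, k%:~R = D%:~R * phi w.
  (* This is [D * phi w], the denominator of [phi w] being cancelled against its factor in [D]. *)
  move=> w; exists (numq (phi w) * \prod_(u <- S | u != w) denq (phi u)).
  rewrite /D (bigD1_seq w) ?fset_uniq //= !intrM mulrAC.
  by rewrite -{3}(divq_num_den (phi w)) mulrCA divff ?mulr1 // intr_eq0 denq_neq0.
exists z; split=> [w|e u m v n es et].
  by rewrite -(intr_eq0 rat) zE mulf_neq0.
apply: (@intr_inj rat); rewrite !intrM !zE.
by rewrite mulrCA [in RHS]mulrCA; congr (_ * _); apply: pot es et.
Qed.

(** * Balance of closed walks *)

(** Crossing [e] with or against its direction; a potential satisfies [a * phi u = b * phi v] in
    both cases. *)
Definition step (G : multiquiver) (u : vertex G) (e : edge G) (v : vertex G)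
    (a b : nat) : Prop :=
  (src e = Some (u, a) /\ tgt e = Some (v, b)) \/
  (src e = Some (v, b) /\ tgt e = Some (u, a)).

Lemma step_sym G u (e : edge G) v a b : step u e v a b -> step v e u b a.
Proof. by case; [right|left]. Qed.

Lemma step_neq G u (e : edge G) v a b : step u e v a b -> u <> v.
Proof.
by case=> -[es et]; [exact: no_loops es et|move/esym; exact: no_loops es et].
Qed.

Lemma step_gt0 G u (e : edge G) v a b : step u e v a b ->
  (0 < a)%N /\ (0 < b)%N.
Proof.
by case=> -[/src_gt0 ? /tgt_gt0 ?].
Qed.

Lemma step_det G u (e : edge G) v a b u' v' a' b' :
  step u e v a b -> step u' e v' a' b' ->
  [/\ u' = u, v' = v, a' = a & b' = b] \/ [/\ u' = v, v' = u, a' = b & b' = a].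
Proof.
by case=> -[es et]; case=> -[]; rewrite es et => -[-> ->] [-> ->];
  first [by left | by right].
Qed.

(* The two factors are the closed walks obtained by cutting a closed walk at
   equal vertices of indices [i] and [j]. *)
Lemma prodn_split (F : nat -> nat) k i j : (i <= j <= k)%N ->
  (\prod_(t < k) F t = (\prod_(t < j - i) F (i + t)%N) *
     (\prod_(t < k - (j - i)) F (if t < i then t : nat else t + (j - i))%N))%N.
Proof.
move=> /andP[ij jk].
rewrite -(big_mkord xpredT F) -(big_mkord xpredT (fun t => F (i + t)%N)).
rewrite -(big_mkord xpredT (fun t => F (if (t < i)%N then t else t + (j - i))%N)).
rewrite (big_cat_nat (n := i)) //=; last exact: leq_trans jk.
rewrite (big_cat_nat (n := j) (m := i)) //=.
rewrite [X in (_ = _ * X)%N](big_cat_nat (n := i)) //=; last by lia.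
rewrite mulnCA; congr (_ * (_ * _))%N.
- rewrite -{1}[i]add0n big_addn; apply: eq_big_nat => t _.
  by rewrite addnC.
- by apply: eq_big_nat => t /andP[_ ->].
rewrite -{1}(subnKC ij) big_addn; apply: eq_big_nat => t /andP[it _].
by rewrite ltnNge it.
Qed.

Section Cycles.
Variable G : multiquiver.
Hypothesis balG : forall (V' : set (vertex G)) (E' : set (edge G)),
  NND_cycle (subgraph V' E') -> balanced_NND_cycle (subgraph V' E').

(** The vertices and edges visited form a subgraph that becomes a directed cycle once the edges
    crossed backwards, collected in [R], are reversed. *)
Lemma simple_closed_walk_balanced k (v : nat -> vertex G) (e : nat -> edge G)
    (a b : nat -> nat) :
  (0 < k)%N ->
  (forall i, (i < k)%N -> step (v i) (e i) (v i.+1) (a i) (b i)) ->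
  v k = v 0%N ->
  (forall i j, (i < k)%N -> (j < k)%N -> v i = v j -> i = j) ->
  (forall i j, (i < k)%N -> (j < k)%N -> e i = e j -> i = j) ->
  (\prod_(i < k) a i = \prod_(i < k) b i)%N.
Proof.
move=> k0 st vk vI eI.
pose V' := [set w | exists2 i, (i < k)%N & w = v i].
pose E' := [set d | exists2 i, (i < k)%N & d = e i].
have vV (i : 'I_k) : v i \in V' by apply/mem_set; exists i; rewrite ?ltn_ord.
have eE (i : 'I_k) : e i \in E' by apply/mem_set; exists i; rewrite ?ltn_ord.
pose vv (i : 'I_k) : V' := exist _ (v i) (vV i).
pose ee (i : 'I_k) : E' := exist _ (e i) (eE i).
have vvS (i : 'I_k) : val (vv (ordS i)) = v i.+1.
  rewrite /=; case: (ltngtP i.+1 k) => [ik|ki|ik].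
  - by rewrite modn_small.
  - by have := ltn_ord i; lia.
  - by rewrite ik modnn vk.
pose R : set E' := [set d | exists2 i : 'I_k, d = ee i &
   src (e i) = Some (v i.+1, b i)].
have bij_of (T : choiceType) (A : set T) (f : nat -> T) (ff : 'I_k -> A) :
    (forall i, val (ff i) = f i) ->
    A = [set w | exists2 i, (i < k)%N & w = f i] ->
    (forall i j, (i < k)%N -> (j < k)%N -> f i = f j -> i = j) -> bijective ff.
  move=> fE AE fI; rewrite -setTT_bijective; split=> //.
    move=> i j _ _ /(congr1 val); rewrite !fE => /fI E.
    by apply/val_inj/E.
  move=> w _; have := set_valP w; rewrite [X in X _]AE => -[i ik wi].
  by exists (Ordinal ik) => //; apply/val_inj; rewrite fE.
have enum : @cyclic_enum (@reverse (subgraph V' E') R) k vv ee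
    (fun i => a i) (fun i => b i).
  have inR (i : 'I_k) : src (e i) = Some (v i, a i) -> ee i \notin R.
    move=> es; apply/negP => /set_mem[j /(congr1 val)/= ij].
    have {}ij : i = j := val_inj (eI _ _ (ltn_ord i) (ltn_ord j) ij).
    subst j; rewrite es => -[vi _].
    by have /(_ vi) := step_neq (st i (ltn_ord i)).
  split=> //.
  - exact: (bij_of _ _ v).
  - exact: (bij_of _ _ e).
  - move=> i; rewrite /= /rev_src; case: (st i (ltn_ord i)) => -[es et].
      by rewrite (negbTE (inR _ es)) /= /sub_src es; apply: restrict_end_in.
    have -> : ee i \in R by apply/mem_set; exists i.
    by rewrite /= /sub_tgt et; apply: restrict_end_in.
  - move=> i; rewrite /= /rev_tgt; case: (st i (ltn_ord i)) => -[es et].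
      rewrite (negbTE (inR _ es)) /= /sub_tgt et.
      by apply: restrict_end_in; rewrite vvS.
    have -> : ee i \in R by apply/mem_set; exists i.
    by rewrite /= /sub_src es; apply: restrict_end_in; rewrite vvS.
have nnd : NND_cycle (subgraph V' E').
  exists (@reverse (subgraph V' E') R); split.
    by exists k, vv, ee, (fun i => a i), (fun i => b i).
  exists R, id, id; split; [by exists id|by exists id| |].
    by move=> d; case: (src _) => [[]|].
  by move=> d; case: (tgt _) => [[]|].
(* The hypothesis balances some directed cycle sign-equivalent to the subgraph; a potential carries
   the balance over to [enum]. *)
have [phi pot] := balanced_NND_potential (balG nnd).
by apply: cyclic_enum_balanced enum _; apply/potential_reverse; exact: pot.
Qed.

(** Strong induction on the length: a walk with a repeated vertex is cut into two shorter ones; any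
    other nonempty walk is a simple cycle or goes back and forth along one edge. *)
Lemma closed_walk_balanced k (v : nat -> vertex G) (e : nat -> edge G)
    (a b : nat -> nat) :
  (forall i, (i < k)%N -> step (v i) (e i) (v i.+1) (a i) (b i)) ->
  v k = v 0%N -> (\prod_(i < k) a i = \prod_(i < k) b i)%N.
Proof.
elim/ltn_ind: k => k IH in v e a b *; move=> st vk.
have [->|k0] := posnP k; first by rewrite !big_ord0.
have [[i [j [ij jk vij]]]|vI] :=
    pselect (exists i j, [/\ (i < j)%N, (j < k)%N & v i = v j]).
  rewrite !(@prodn_split _ k i j) ?(ltnW ij) ?(ltnW jk) //.
  congr (_ * _)%N.
    apply: (IH _ _ (fun t => v (i + t)%N) (fun t => e (i + t)%N)
      (fun t => a (i + t)%N) (fun t => b (i + t)%N)); first by lia.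
      by move=> t tj; rewrite addnS; apply: st; lia.
    by rewrite addn0 vij; congr v; lia.
  pose h t := (if t < i then t else t + (j - i))%N.
  (* At the cut [t = i] both branches agree, because [v i = v j]. *)
  apply: (IH _ _ (fun t => if (t <= i)%N then v t else v (t + (j - i))%N)
    (fun t => e (h t)) (fun t => a (h t)) (fun t => b (h t))); first by lia.
    move=> t tk; have := st (h t); rewrite /h.
    case: (ltngtP t i) => [ti|it|->] E.
    - by rewrite ?ti; apply: E; lia.
    - by rewrite addSn; apply: E; lia.
    - have ijK : (i + (j - i) = j)%N by lia.
      by rewrite addSn vij ijK in E *; apply: E.
  rewrite /= ifF; last by lia.
  by rewrite -vk; congr v; lia.
have {}vI i j : (i < k)%N -> (j < k)%N -> v i = v j -> i = j.
  move=> ik jk vij; case: (ltngtP i j) => // ij; case: vI.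
    by exists i, j.
  by exists j, i.
(* Going out and back along one edge traces no cycle, but then both products have the same two
   factors. *)
have [e2|ne2] := pselect (k = 2%N /\ e 0%N = e 1%N).
  case: e2 => k2 e01; subst k; rewrite !big_ord_recr !big_ord0 /= !mul1n.
  have s0 := st 0%N isT; have := st 1%N isT; rewrite -e01 => s1.
  case: (step_det s0 s1) => -[v1 _ -> ->]; last by rewrite mulnC.
  by case: (step_neq s0).
apply: (@simple_closed_walk_balanced k v e a b) => // i j.
wlog ij : i j / (i < j)%N => [H ik jk eij|].
  by case: (ltngtP i j) => // ij; [apply: H|apply/esym/H].
(* An edge crossed twice in the same direction repeats a vertex; in opposite directions,
   distinctness of the vertices forces [j = i.+1] and then [k = 2]. *)
move=> ik jk eij; have s1 := st i ik; have := st j jk; rewrite -eij => s2.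
case: (step_det s1 s2) => -[vj vj1 _ _].
  by have := vI _ _ ik jk (esym vj); lia.
have jE : j = i.+1 by apply: vI => //; lia.
subst j; case: (ltngtP i.+2 k) => [ik2|ik2|ik2].
- by have := vI _ _ ik2 ik vj1; lia.
- by lia.
- have i0 : i = 0%N by apply: vI; rewrite // -vj1 ik2.
  by case: ne2; subst i; split.
Qed.

End Cycles.

(** * Products of multiplicities along walks *)

(* [walk u v A B]: some walk from [u] to [v] has [A], resp. [B], as the product
   of its multiplicities at the ends where it enters, resp. leaves, its edges;
   a potential is multiplied by [A / B] along it. *)
Inductive walk (G : multiquiver) (u : vertex G) :
    vertex G -> nat -> nat -> Prop :=
| walk_refl : walk u u 1 1
| walk_step v e w A B a b : walk u v A B -> step v e w a b ->
    walk u w (A * a) (B * b).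

Lemma walk_gt0 G (u v : vertex G) A B : walk u v A B -> (0 < A)%N /\ (0 < B)%N.
Proof.
elim=> // w e w' C D a b _ [C0 D0] /step_gt0[a0 b0].
by rewrite !muln_gt0 C0 D0 a0 b0.
Qed.

Lemma walk_trans G (u v w : vertex G) A B C D :
  walk u v A B -> walk v w C D -> walk u w (A * C) (B * D).
Proof.
move=> uv; elim=> [|x e y C' D' a b _ IH st]; first by rewrite !muln1.
by rewrite !mulnA; apply: walk_step IH st.
Qed.

Lemma walk_sym G (u v : vertex G) A B : walk u v A B -> walk v u B A.
Proof.
elim=> [|x e y C' D' a b _ IH st]; first exact: walk_refl.
rewrite mulnC (mulnC _ a); apply: walk_trans IH.
by rewrite -(mul1n a) -(mul1n b); apply: walk_step (step_sym st); apply: walk_refl.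
Qed.

(* The trivial walk is singled out because a multiquiver may have no edge to
   serve as a value of [e]. *)
Lemma walk_seq G (u w : vertex G) A B : walk u w A B ->
  [/\ u = w, A = 1%N & B = 1%N] \/
  exists k (v : nat -> vertex G) (e : nat -> edge G) (a b : nat -> nat),
    [/\ forall i, (i < k)%N -> step (v i) (e i) (v i.+1) (a i) (b i),
        v 0%N = u, v k = w, A = (\prod_(i < k) a i)%N
      & B = (\prod_(i < k) b i)%N].
Proof.
elim=> [|x d y C D c c' _ IH st]; [by left|right].
case: IH => [[ux -> ->]|[k [v [e [a [b [vst v0 vk -> ->]]]]]]].
  exists 1%N, (fun i => if i is 0%N then u else y), (fun=> d), (fun=> c), (fun=> c').
  by rewrite !big_ord1 !mul1n; split=> // -[|//] _; rewrite ux.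
(* A walk has one more vertex than edges, hence the two different bounds. *)
pose upd T (f : nat -> T) z i := if (i <= k)%N then f i else z.
pose updl T (f : nat -> T) z i := if (i < k)%N then f i else z.
exists k.+1, (upd _ v y), (updl _ e d), (updl _ a c), (updl _ b c').
have prodE f z : (\prod_(i < k.+1) updl nat f z i = \prod_(i < k) f i * z)%N.
  rewrite big_ord_recr /= {2}/updl ltnn; congr (_ * _)%N.
  by apply: eq_bigr => i _; rewrite /updl ltn_ord.
split=> //; [move=> i ik|by rewrite /upd ltnn].
rewrite /upd /updl -ltnS ik; case: (ltngtP i k) => [ik'|ki|->].
- exact: vst.
- by lia.
- by rewrite vk.
Qed.

(** * Connected components and their potentials *)

Definition connected (G : multiquiver) : Prop := forall x y, @component G x y.

(** The condition is an equivalence because the closure is symmetric. *)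
Lemma component_ind G (P : vertex G + edge G -> Prop) :
  (forall v e, incident (inl v) (inr e) -> P (inl v) <-> P (inr e)) ->
  forall x y, component x y -> P x -> P y.
Proof.
move=> Pinc x y xy; suff [] : P x <-> P y by [].
elim: xy => {x y} [x y|x|x y _ IH|x y z _ IH1 _ IH2] //.
- by case: x y => [v|//] [//|e]; apply: Pinc.
- by split=> /IH.
- by split=> [/IH1/IH2|/IH2/IH1].
Qed.

Lemma equilibrium_walk_balanced G (u : vertex G) A B :
  in_equilibrium G -> walk u u A B -> A = B.
Proof.
move=> [_ _ balG] /walk_seq[[_ -> ->] //|[k [v [e [a [b [st v0 vk -> ->]]]]]]].
by apply: closed_walk_balanced st _; rewrite // vk.
Qed.

Lemma connected_walk G (r v : vertex G) :
  connected G -> exists A B, walk r v A B.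
Proof.
move=> conn.
pose reach w := exists A B, @walk G r w A B.
(* Chains in a component alternate between vertices and edges, while walks end at vertices: an edge
   counts as reached when one of its ends is. *)
pose P (x : vertex G + edge G) := match x with
  | inl w => reach w
  | inr e => exists w n, (src e = Some (w, n) \/ tgt e = Some (w, n)) /\ reach w
  end.
apply: (@component_ind G P _ (inl r) (inl v) (conn _ _)); last first.
  by exists 1%N, 1%N; apply: walk_refl.
move=> w e /= [n we]; split=> [rw|[w' [n' [w'e [A [B rw']]]]]].
  by exists w, n.
suff [<-|[a [b st]]] : w' = w \/ exists a b, step w' e w a b.
- by exists A, B.
- by exists (A * a)%N, (B * b)%N; apply: walk_step rw' st.
case: we w'e => we [w'e|w'e].
- by left; move: we; rewrite w'e => -[].
- by right; exists n', n; right.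
- by right; exists n', n; left.
- by left; move: we; rewrite w'e => -[].
Qed.

(** The value at [v] is [A / B] for some walk from the base vertex [r]; balance of closed walks
    makes the choice of the walk immaterial. *)
Lemma equilibrium_potential G : connected G -> in_equilibrium G ->
  vertex G -> exists phi, @potential G phi.
Proof.
move=> conn eqG r.
have /choice[A /choice[B wAB]] := fun v => connected_walk r v conn.
have A0 v : (A v)%:R != 0 :> rat.
  by rewrite pnatr_eq0 -lt0n; have [] := walk_gt0 (wAB v).
have B0 v : (B v)%:R != 0 :> rat.
  by rewrite pnatr_eq0 -lt0n; have [] := walk_gt0 (wAB v).
exists (fun v => (A v)%:R / (B v)%:R); split=> [v|e u m v n es et].
  by rewrite mulf_neq0 ?invr_eq0.
(* The closed walk goes from [r] to [u], across [e] to [v], and back to [r]. *)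
have := walk_trans (walk_step (wAB u) (or_introl (conj es et)))
                   (walk_sym (wAB v)).
move=> /(equilibrium_walk_balanced eqG)/(congr1 (fun k => k%:R : rat)).
rewrite !natrM => E; apply: (mulIf (mulf_neq0 (B0 u) (B0 v))).
transitivity ((A u)%:R * m%:R * (B v)%:R : rat).
  by field; rewrite B0.
by rewrite E; field; rewrite B0.
Qed.

Lemma component_trans G (x y z : vertex G + edge G) :
  component x y -> component y z -> component x z.
Proof. exact: rst_trans. Qed.

Lemma component_sym G (x y : vertex G + edge G) :
  component x y -> component y x.
Proof. exact: rst_sym. Qed.

Lemma component_eq G (x y : vertex G + edge G) :
  component x y -> component x = component y.
Proof.
move=> xy; apply/seteqP; split=> z; apply: component_trans => //.
exact: component_sym.
Qed.

Lemma component_end G (x : vertex G + edge G) v e n :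
  src e = Some (v, n) \/ tgt e = Some (v, n) ->
  component x (inl v) <-> component x (inr e).
Proof.
move=> ve; have inc : component (inl v) (inr e).
  by apply: rst_step; exists n.
split=> xz; first exact: component_trans inc.
exact: component_trans (component_sym inc).
Qed.

(** A component contains the ends of its edges and the edges at its vertices, so a chain from [x0]
    in [G] lifts to the component graph. *)
Lemma component_graph_connected G (x0 : vertex G + edge G) :
  connected (component_graph (component x0)).
Proof.
set C := component x0; set H := component_graph C.
pose toG (y : vertex H + edge H) : vertex G + edge G :=
  match y with inl v => inl (val v) | inr e => inr (val e) end.
have toG_inj : injective toG.
  by move=> [v|e] [v'|e'] //= [] /val_inj ->.
have C_toG y : C (toG y) by case: y => z; exact: set_valP z.
have toG_onto y : C y -> exists y', toG y' = y.
  case: y => z Cz.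
    by exists (inl (exist _ z (mem_set (Cz : [set v | C (inl v)] z)))).
  by exists (inr (exist _ z (mem_set (Cz : [set e | C (inr e)] z)))).
have [x0' x0E] : exists y, toG y = x0 by apply: toG_onto; apply: rst_refl.
have inc (v : vertex H) (e : edge H) :
    incident (toG (inl v)) (toG (inr e)) -> @incident H (inl v) (inr e).
  move=> [n ve]; exists n => /=; rewrite /sub_src /sub_tgt.
  by case: ve => ->; [left|right]; apply: restrict_end_in.
pose P y := exists2 y', toG y' = y & @component H x0' y'.
have all_x0' z : @component H x0' z.
  suff [y' /toG_inj -> //] : P (toG z).
  apply: (@component_ind G P _ x0 _ (C_toG z)); last first.
    by exists x0' => //; apply: rst_refl.
  move=> v e ve; have [n ve'] := ve.
  split=> -[y' yE x0y'].
    have [e' eE] : exists e', toG e' = inr e.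
      by apply: toG_onto; apply/(component_end _ ve'); rewrite -yE; apply: C_toG.
    exists e' => //.
    case: y' e' yE eE x0y' => [v'|//] [//|e'] vE eE x0v'.
    apply: component_trans x0v' _; apply/rst_step/inc.
    by rewrite vE eE.
  have [v' vE] : exists v', toG v' = inl v.
    by apply: toG_onto; apply/(component_end _ ve'); rewrite -yE; apply: C_toG.
  exists v' => //.
  case: y' v' yE vE x0y' => [//|e'] [v'|//] eE vE x0e'.
  apply: component_trans x0e' _; apply/component_sym/rst_step/inc.
  by rewrite vE eE.
by move=> x y; apply: component_trans (all_x0' y); apply: component_sym.
Qed.

(** * Coefficients in free abelian groups *)

Lemma coeff_sum_uniq (K : choiceType) (s : seq K) (c : K -> int) v : uniq s ->
  coeff v (\sum_(w <- s) << c w *g w >>) = if v \in s then c v else 0.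
Proof.
move=> us; rewrite raddf_sum /=; case: ifPn => vs.
  rewrite (bigD1_seq v) //= coeffU eqxx mulr1 big1 ?addr0 // => w /negbTE wv.
  by rewrite coeffU wv mulr0.
rewrite big_seq big1 // => w ws; rewrite coeffU.
by case: eqP vs => [<-|_ _]; [rewrite ws|rewrite mulr0].
Qed.

Lemma freeg_coeffP (K : choiceType) (x y : {freeg K / int}) :
  (forall v, coeff v x = coeff v y) -> x = y.
Proof. by move=> xy; apply/eqP/freeg_eqP. Qed.

Lemma coeffMz (K : choiceType) (x : {freeg K / int}) q v :
  coeff v (x *~ q) = coeff v x * q.
Proof. by rewrite raddfMz /= -mulrzr intz. Qed.

(** * The kernel, one component at a time *)

Section Kernel.
Variable G : multiquiver.
Implicit Types (x y : {freeg (vertex G) / int}) (C : set (vertex G + edge G)).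

(** The contribution of one end of an edge to its equation; the value 0 at an empty end makes a leaf
    force [x] to vanish at its other end, if any. *)
Definition end_value x (o : option (vertex G * nat)) : int :=
  if o is Some (v, n) then n%:Z * coeff v x else 0.

Lemma incidence_coefE (e : edge G) v : incidence_coef e v =
  end_value << v >> (tgt e) - end_value << v >> (src e).
Proof.
rewrite /incidence_coef /end_value.
case et: (tgt e) => [[u n]|]; case es: (src e) => [[w m]|];
  rewrite ?coeffU ?mul1r ?subr0 ?sub0r ?(eq_sym v) //.
- case: (u =P v) => [uv|_]; case: (w =P v) => [wv|_];
    rewrite ?mulr1 ?mulr0 ?subr0 ?sub0r ?oppr0 //.
  by case: (no_loops es et); rewrite uv.
- by case: eqP; rewrite ?mulr1 ?mulr0.
- by case: eqP; rewrite ?mulr1 ?mulr0 ?oppr0.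
Qed.

(** Local finiteness confines the support to a finite set of edges, which turns the sum into an
    ordinary one. *)
Lemma coeff_incidence_gen (e : edge G) v :
  coeff e (\sum_(d \in [set: edge G]) << incidence_coef d v *g d >>) =
  incidence_coef e v.
Proof.
have [S SE] := finite_fsetP.1 (locally_finite v).
have [sub _] := (seteqP _ _).1 SE.
have out d : d \notin S -> incidence_coef d v = 0.
  move=> dS; have nd : ~ ((exists n, src d = Some (v, n)) \/
      (exists n, tgt d = Some (v, n))).
    by move=> dv; move/negP: dS; apply; exact: (sub d dv).
  have nt u n : tgt d = Some (u, n) -> (u == v) = false.
    by move=> et; apply/eqP => uv; apply: nd; right; exists n; rewrite et uv.
  have ns u n : src d = Some (u, n) -> (u == v) = false.
    by move=> es; apply/eqP => uv; apply: nd; left; exists n; rewrite es uv.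
  rewrite /incidence_coef; case et: (tgt d) => [[u n]|];
    case es: (src d) => [[w m]|] //; by rewrite ?(nt _ _ et) ?(ns _ _ es).
rewrite (fsbigTE S) => [|d dS]; last by rewrite out // freegU0.
rewrite coeff_sum_uniq ?fset_uniq //.
by case: ifPn => // /out.
Qed.

Lemma end_value_sum x o :
  end_value x o = \sum_(v <- dom x) coeff v x * end_value << v >> o.
Proof.
case: o => [[u n]|] /=; last by rewrite big1 // => v _; rewrite mulr0.
rewrite -{1}(freeg_sumE x) raddf_sum mulr_sumr; apply: eq_bigr => v _ /=.
by rewrite !coeffU mul1r mulrCA.
Qed.

Lemma coeff_incidence x (e : edge G) :
  coeff e (incidence x) = end_value x (tgt e) - end_value x (src e).
Proof.
rewrite !end_value_sum -sumrB.
pose F (v : vertex G) : {freeg (edge G) / int} :=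
  \sum_(d \in [set: edge G]) << incidence_coef d v *g d >>.
(* [fglift F] is packaged as an additive map so that it commutes with the expansion of [x] in
   generators. *)
pose A := GRing.isZmodMorphism.Build _ _ (fglift F) (lift_is_additive F).
pose addF : {additive {freeg (vertex G) / int} -> {freeg (edge G) / int}} :=
  HB.pack (fglift F) A.
have -> : incidence x = addF x by [].
rewrite -{1}(freeg_sumE x) !raddf_sum; apply: eq_bigr => v _ /=.
by rewrite liftU coeffZ coeff_incidence_gen incidence_coefE mulrBr.
Qed.

Lemma incidence_kerP x : incidence_ker G x <->
  forall e, end_value x (src e) = end_value x (tgt e).
Proof.
split=> [x0 e|xe].
  apply/eqP; rewrite eq_sym -subr_eq0 -coeff_incidence.
  by rewrite (x0 : incidence x = 0) coeff0.
apply: freeg_coeffP => e; rewrite coeff_incidence xe subrr.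
by rewrite coeff0.
Qed.

Lemma incidence_kerBMz x y q : incidence_ker G x -> incidence_ker G y ->
  incidence_ker G (x - y *~ q).
Proof.
move=> /incidence_kerP Kx /incidence_kerP Ky; apply/incidence_kerP => e.
have E o : end_value (x - y *~ q) o = end_value x o - end_value y o * q.
  case: o => [[v n]|] /=; last by rewrite mul0r subr0.
  by rewrite coeffB coeffMz mulrBr mulrA.
by rewrite !E Kx Ky.
Qed.

(** Multiplicities are nonzero and both ends of an edge give the same value, so vanishing passes
    between an edge and its ends. *)
Lemma kernel_vanish x : incidence_ker G x ->
  forall a b : vertex G + edge G, component a b ->
  let P t := match t with
    | inl v => coeff v x = 0
    | inr e => end_value x (src e) = 0
    end in P a -> P b.
Proof.
move=> /incidence_kerP Kx a b ab P; apply: (component_ind _ ab) => v e [n].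
rewrite /P; case=> ve; rewrite ?[src e]ve ?Kx ?[tgt e]ve /=.
  split=> [->|/eqP]; first by rewrite mulr0.
  by rewrite mulf_eq0 eqz_nat (gtn_eqF (src_gt0 ve)) => /eqP.
split=> [->|/eqP]; first by rewrite mulr0.
by rewrite mulf_eq0 eqz_nat (gtn_eqF (tgt_gt0 ve)) => /eqP.
Qed.

(** By [kernel_vanish], [x] is nonzero on the whole component: its vertices lie in the finite
    support, a leaf would force the value 0, and [x] itself is a potential. *)
Lemma kernel_component_equilibrium x v :
  incidence_ker G x -> coeff v x != 0 ->
  equilibrium_components G (component (inl v)).
Proof.
move=> Kx xv; set C := component (inl v); split; first by exists (inl v).
have nz w : C (inl w) -> coeff w x != 0.
  move=> Cw; apply: contra_neq xv => xw.
  exact: (kernel_vanish Kx (component_sym Cw)).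
have nze e : C (inr e) -> end_value x (src e) != 0.
  move=> Ce; apply: contra_neq xv => xe.
  exact: (kernel_vanish Kx (component_sym Ce)).
have /incidence_kerP Kx' := Kx.
have in_end e u n (Ce : C (inr e)) :
    src e = Some (u, n) \/ tgt e = Some (u, n) -> C (inl u).
  by move=> ue; apply/(component_end _ ue).
split.
- have vI : {in (val : vertex (component_graph C) -> _) @^-1` [set` dom x] &,
      injective (val : vertex (component_graph C) -> _)}.
    by move=> ? ? _ _; apply: val_inj.
  apply: sub_finite_set (finite_preimage vI (finite_seq (dom x))) => w _ /=.
  by rewrite mem_dom; apply: nz; apply: (set_valP w).
- move=> e; have Ce : C (inr (val e)) := set_valP e.
  have xe := nze _ Ce; have xe' : end_value x (tgt (val e)) != 0 by rewrite -Kx'.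
  case=> /=; rewrite /sub_src /sub_tgt.
    case es: (src (val e)) xe => [[u n]|//] _ /=.
    have Cu : C (inl u) by apply: in_end Ce _; left; apply: es.
    by rewrite insubT //; apply/mem_set.
  case et: (tgt (val e)) xe' => [[u n]|//] _ /=.
  have Cu : C (inl u) by apply: in_end Ce _; right; apply: et.
  by rewrite insubT //; apply/mem_set.
- move=> V' E'; pose phi (w : vertex (component_graph C)) : rat :=
    (coeff (val w) x)%:~R.
  suff pot : potential phi.
    exact: potential_balanced_NND (potential_subgraph V' E' pot).
  split=> [w|e u m w n es et].
    by rewrite intr_eq0; apply: nz; apply: (set_valP w).
  have := Kx' (val e); rewrite (restrict_endP es) (restrict_endP et) /=.
  by move=> /(congr1 (fun k : int => k%:~R : rat)); rewrite !intrM.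
Qed.

Definition supported C x := forall v, coeff v x != 0 -> C (inl v).

(** The element is an integral multiple of a potential on the component, extended by zero. *)
Lemma equilibrium_kernel C : equilibrium_components G C ->
  exists r x, [/\ C (inl r), incidence_ker G x, supported C x & coeff r x != 0].
Proof.
move=> [[x0 _ CE] eqC]; subst C; set C := component x0 in eqC *.
have [finV noleaf _] := eqC.
have in_C (e : edge G) u n : src e = Some (u, n) \/ tgt e = Some (u, n) ->
    C (inl u) <-> C (inr e) by move=> ue; apply: component_end ue.
have Cx0 : C x0 by apply: rst_refl.
have noleafG e : C (inr e) -> exists u m v n,
    src e = Some (u, m) /\ tgt e = Some (v, n).
  move=> Ce; have := noleaf (exist _ e (mem_set (Ce : [set e | C (inr e)] e))).
  rewrite /leaf /= /sub_src /sub_tgt /=.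
  case: (src e) => [[u m]|]; last by case; left.
  case: (tgt e) => [[v n]|]; last by case; right.
  by exists u, m, v, n.
(* A component given by an edge has a vertex too, since that edge is not a leaf. *)
have [r Cr] : exists r, C (inl r).
  case: x0 @C eqC {finV noleaf} in_C Cx0 noleafG => [v|e] C _ in_C Cx0 noleafG.
    by exists v.
  have [u [m [v [n [es _]]]]] := noleafG _ Cx0.
  by exists u; apply/(in_C e u m) => //; left.
pose H := component_graph C.
pose r' : vertex H := exist _ r (mem_set (Cr : [set v | C (inl v)] r)).
have [phi pot] := equilibrium_potential (@component_graph_connected G x0) eqC r'.
have [z [z0 zP]] := potential_clear_denominators pot finV.
have [S SE] := finite_fsetP.1 finV.
have inS w : w \in S := ((seteqP _ _).1 SE).1 w I.
pose zz (v : vertex G) : int := if insub v is Some w then z w else 0.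
have zzE (w : vertex H) : zz (val w) = z w by rewrite /zz valK.
have zz0 v : ~ C (inl v) -> zz v = 0.
  by move=> nCv; rewrite /zz insubF //; apply/negbTE/negP => /set_mem.
pose x := \sum_(v <- [seq val w | w <- S]) << zz v *g v >>.
have xE v : coeff v x = zz v.
  have uS : uniq [seq val w | w <- S].
    by rewrite (map_inj_uniq val_inj) fset_uniq.
  rewrite coeff_sum_uniq //.
  case: ifPn => // vS; rewrite zz0 // => Cv; move/negP: vS; apply.
  have -> : v = val (exist _ v (mem_set (Cv : [set v | C (inl v)] v)) : vertex H).
    by [].
  by rewrite map_f.
exists r, x; split=> //.
- apply/incidence_kerP => e; have [Ce|nCe] := pselect (C (inr e)).
    have [u [m [v [n [es et]]]]] := noleafG _ Ce.
    have Cu : C (inl u) by apply/(in_C e u m) => //; left.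
    have Cv : C (inl v) by apply/(in_C e v n) => //; right.
    pose e' : edge H := exist _ e (mem_set (Ce : [set e | C (inr e)] e)).
    pose u' : vertex H := exist _ u (mem_set (Cu : [set v | C (inl v)] u)).
    pose v' : vertex H := exist _ v (mem_set (Cv : [set v | C (inl v)] v)).
    rewrite es et /= !xE (zzE u') (zzE v').
    apply: (zP e').
      by rewrite /= /sub_src /= es; apply: (@restrict_end_in _ _ u').
    by rewrite /= /sub_tgt /= et; apply: (@restrict_end_in _ _ v').
  (* An edge outside [C] has no end in [C], so both sides of its equation vanish. *)
  have z_end o : (forall u n, o = Some (u, n) ->
      src e = Some (u, n) \/ tgt e = Some (u, n)) -> end_value x o = 0.
    case: o => [[u n]|//] oE; rewrite /= xE zz0 ?mulr0 // => Cu.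
    by apply/nCe/(in_C e u n); first exact: oE.
  by rewrite !z_end // => u n ->; [right|left].
- by move=> v; rewrite xE; apply: contra_neqP => /zz0.
- by rewrite xE (zzE r').
Qed.

(** A kernel element supported on [C] is determined by its value at one vertex [r] of [C], and these
    values form a nonzero subgroup of the integers. *)
Lemma equilibrium_generator C : equilibrium_components G C ->
  exists b, [/\ incidence_ker G b, supported C b, exists v, coeff v b != 0
    & forall y, incidence_ker G y -> supported C y -> exists q, y = b *~ q].
Proof.
move=> eqC; have [r [x [Cr Kx Cx xr]]] := equilibrium_kernel eqC.
have K0 : incidence_ker G 0.
  by apply/incidence_kerP => e; case: (src e) (tgt e) => [[? ?]|] [[? ?]|];
    rewrite /= ?coeff0 ?mulr0.
have suppBMz y b q : supported C y -> supported C b -> supported C (y - b *~ q).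
  move=> Cy Cb v; rewrite coeffB coeffMz => yb.
  have [/Cy//|/negPn/eqP y0] := boolP (coeff v y != 0).
  apply: Cb; apply: contra_neq yb => ->; by rewrite y0 mul0r subr0.
(* The generator has the least positive value at [r]. *)
pose Q n := `[< (0 < n)%N /\
  exists b, [/\ incidence_ker G b, supported C b & coeff r b = n%:Z] >].
have exQ : exists n, Q n.
  exists `|coeff r x|%N; apply/asboolP; split; first by rewrite absz_gt0.
  (* This is [x] up to sign, made positive at [r], in the form that [incidence_kerBMz] accepts. *)
  exists (0 - x *~ (- Num.sg (coeff r x))); split.
  - exact: incidence_kerBMz.
  - by apply: suppBMz => // v; rewrite coeff0 eqxx.
  - by rewrite coeffB coeffMz coeff0 mulrN sub0r opprK mulrC -normrEsg abszE.
have [d /asboolP[d0 [b [Kb Cb br]]] dmin] := ex_minnP exQ.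
exists b; split=> //; first by exists r; rewrite br eqz_nat -lt0n.
move=> y Ky Cy; exists (coeff r y %/ d)%Z.
set q := (_ %/ _)%Z; set t := y - b *~ q.
have Kt : incidence_ker G t by apply: incidence_kerBMz.
have Ct : supported C t by apply: suppBMz.
have tr : coeff r t = (coeff r y %% d)%Z.
  by rewrite /t coeffB coeffMz br {1}(divz_eq (coeff r y) d) mulrC addrC addKr.
(* The remainder takes at [r] a value in [[0, d)], which the minimality of [d] forces to be 0. *)
have tr0 : coeff r t = 0.
  have dz : (d%:Z != 0) by rewrite eqz_nat -lt0n.
  have := modz_ge0 (coeff r y) dz; have := ltz_pmod (coeff r y) (d0 : 0 < d%:Z).
  rewrite -tr => td t0; apply/eqP; case: eqP => // /eqP tn0.
  have /dmin : Q `|coeff r t|%N.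
    apply/asboolP; split; first by rewrite absz_gt0.
    by exists t; split=> //; rewrite gez0_abs.
  by move: td t0 tn0; lia.
apply/eqP; rewrite -subr_eq0; apply/eqP/freeg_coeffP => v; rewrite coeff0.
have [//|tv] := eqVneq (coeff v t) 0; have Cv := Ct v tv.
case: eqC => -[x0 _ CE] _; subst C.
exact: (kernel_vanish Kt (component_trans (component_sym Cr) Cv)).
Qed.

(** An edge lies in [C] together with its ends or not at all, so cutting [x] down to [C] preserves
    every edge equation. *)
Lemma kernel_split x C : components C -> incidence_ker G x ->
  exists y, [/\ incidence_ker G y, supported C y
    & forall v, coeff v y = if `[< C (inl v) >] then coeff v x else 0].
Proof.
move=> [x0 _ CE] Kx; subst C; set C := component x0.
pose y := \sum_(v <- [seq v <- dom x | `[< C (inl v) >]]) << coeff v x *g v >>.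
have yE v : coeff v y = if `[< C (inl v) >] then coeff v x else 0.
  rewrite coeff_sum_uniq ?filter_uniq ?uniq_dom // mem_filter mem_dom.
  by case: asboolP => //= _; case: eqP.
exists y; split=> //; last by move=> v; rewrite yE; case: asboolP; rewrite ?eqxx.
have /incidence_kerP Kx' := Kx; apply/incidence_kerP => e.
have E o : (forall u n, o = Some (u, n) ->
      src e = Some (u, n) \/ tgt e = Some (u, n)) ->
    end_value y o = if `[< C (inr e) >] then end_value x o else 0.
  case: o => [[u n]|] /= oE; last by case: ifP.
  have -> : C (inr e) = C (inl u).
    by apply/esym/propext/(component_end _ (oE _ _ erefl)).
  by rewrite yE; case: ifP; rewrite ?mulr0.
by rewrite !E ?Kx' // => u n ->; [right|left].
Qed.

End Kernel.

(** * The basis of the kernel *)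

(** A list of pairs may repeat an element, while an expansion in a basis gives each element one
    coefficient; the coefficients of equal elements are added. *)
Lemma sum_pairs_collect (M : zmodType) (l : seq (M * int)) :
  exists c : M -> int, \sum_(p <- l) p.1 *~ p.2 =
    \sum_(b <- undup [seq p.1 | p <- l]) b *~ c b.
Proof.
exists (fun b => \sum_(p <- l | p.1 == b) p.2).
under [RHS]eq_bigr => b _ do rewrite raddf_sum big_mkcond /=.
rewrite exchange_big /= big_seq [RHS]big_seq; apply: eq_bigr => p pl.
rewrite (bigD1_seq p.1) ?undup_uniq ?mem_undup ?map_f //= eqxx big1 ?addr0 //.
by move=> b; rewrite eq_sym => /negbTE->.
Qed.

Theorem theorem4p8 (G : multiquiver) :
  free_of_rank (incidence_ker G) (equilibrium_components G).
Proof.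
have /choice[b bP] : forall C, exists b : {freeg (vertex G) / int},
    equilibrium_components G C ->
    [/\ incidence_ker G b, supported C b, exists v, coeff v b != 0
      & forall y, incidence_ker G y -> supported C y -> exists q, y = b *~ q].
  move=> C; have [/equilibrium_generator[b bP]|nC] :=
    pselect (equilibrium_components G C); first by exists b.
  by exists 0 => /nC.
(* Generators of different components have disjoint supports, which gives both the injectivity of
   [b] and linear independence. *)
have sep C C' v : equilibrium_components G C -> equilibrium_components G C' ->
    coeff v (b C) != 0 -> coeff v (b C') != 0 -> C = C'.
  move=> eC eC'; have [_ bC _ _] := bP _ eC; have [_ bC' _ _] := bP _ eC'.
  move=> /bC Cv /bC'; case: eC eC' Cv => -[x _ <-] _ [[y _ <-] _].
  by move=> /component_eq-> /component_eq->.
exists (b @` equilibrium_components G); split; last first.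
  apply: inj_card_eq => C C' /set_mem eC /set_mem eC' bCC'.
  have [_ _ [v bv] _] := bP _ eC.
  by apply: (sep _ _ v) => //; rewrite -bCC'.
split.
- by move=> _ [C eC <-]; have [] := bP _ eC.
- move=> x Kx; suff [l lB ->] : exists2 l : seq ({freeg (vertex G) / int} * int),
      (forall p, p \in l -> (b @` equilibrium_components G) p.1)
      & x = \sum_(p <- l) p.1 *~ p.2.
    have [c cE] := sum_pairs_collect l.
    exists (undup [seq p.1 | p <- l]), c; split=> // y /=.
    by rewrite mem_undup => /mapP[p /lB Bp ->].
  (* Induction on a bound for the size of the support, removing one component at a time. *)
  move: {2}(size _) (leqnn (size (dom x))) => k.
  elim: k x Kx => [|k IH] x Kx.
    rewrite leqn0 size_eq0 dom_eq0 => /eqP->.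
    by exists [::]; rewrite ?big_nil.
  move=> xk; have [->|x0] := eqVneq x 0.
    by exists [::]; rewrite ?big_nil.
  have [v vx] : exists v, v \in dom x.
    by move: x0; rewrite -dom_eq0; case: (dom x) => // v s _; exists v; rewrite mem_head.
  move: (vx); rewrite mem_dom => xv.
  have eC := kernel_component_equilibrium Kx xv.
  set C := component (inl v) in eC.
  have [y [Ky Cy yE]] := kernel_split eC.1 Kx.
  have [Kb Cb _ gen] := bP _ eC; have [q yq] := gen _ Ky Cy.
  have Kxy := incidence_kerBMz q Kx Kb; rewrite -yq in Kxy.
  have [|l lB lE] := IH _ Kxy.
    rewrite -ltnS; apply: leq_trans xk.
    (* Subtracting [y] removes [v] from the support and adds nothing to it. *)
    apply: (@uniq_leq_size _ (v :: dom (x - y))) => [|w].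
      rewrite /= uniq_dom mem_dom coeffB yE ifT ?subrr ?eqxx //.
      by apply/asboolP; apply: rst_refl.
    rewrite inE => /orP[/eqP->//|]; rewrite !mem_dom coeffB yE.
    by case: ifP; rewrite ?subrr ?eqxx // subr0.
  exists ((b C, q) :: l) => [p|].
    by rewrite inE => /orP[/eqP->|/lB//]; exists C.
  by rewrite big_cons /= -lE -yq addrC subrK.
(* At a vertex where [d] is nonzero, every other member of [s] vanishes. *)
- move=> s c us sB s0 d ds; have [C eC bC] := sB _ ds.
  have [_ _ [v bv] _] := bP _ eC.
  move: s0 => /(congr1 (coeff v)); rewrite raddf_sum coeff0 /=.
  rewrite (bigD1_seq d) //= big_seq_cond big1 ?addr0 => [|d' /andP[d's d'd]].
    by rewrite coeffMz => /eqP; rewrite mulf_eq0 -bC (negbTE bv) => /eqP.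
  have [C' eC' bC'] := sB _ d's; rewrite coeffMz.
  have [->|bv'] := eqVneq (coeff v d') 0; first by rewrite mul0r.
  move: d'd; rewrite -bC' -bC; case/eqP; congr b.
  by apply: (sep _ _ v) => //; rewrite bC'.
Qed.
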